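(* Let $V=V_0\oplus V_1\oplus V_2$ with $V_0=\langle v\rangle$, $V_1=\langle w\rangle$, $V_2=\langle x\rangle$ one-dimensional, equipped with the skew symmetric linear operators $l_r:V^{\otimes r}\to V$ of degree $2-r$ ($r\ge 1$) given by constants $a_r,b_r,c_r$ via $$l_r(v\otimes w^{\otimes r-1})=a_r w\ (r\ge1),\qquad l_r(w^{\otimes r})=b_r x\ (r\ge 1),\qquad l_r(v\otimes w^{\otimes r-2}\otimes x)=c_r x\ (r\ge 2),$$ and $c_1:=0$. Then $V$ is $L_\infty$ if and only if one of the following holds: (i) $b_p=0$ for all $p\in\mathbb N$; or (ii) there exists $k\in\mathbb N$ such that $b_p=0$ for all $p<k$, $b_k\neq 0$, and for all $m\in\mathbb N$, $$a_m=\left(\tfrac{m-1}{k}\right)c_m+\frac{\sum_{p=2}^{m-1}(-1)^{p(m+k)}\,b_{m+k-p}\left[\binom{m+k-2}{p-1}a_p-\binom{m+k-2}{p-2}c_p\right]}{(-1)^{m(m+k)+1}\binom{m+k-2}{m-1}\,b_k}.$$ (Here $\mathbb N=\{1,2,3,\dots\}$ and empty sums are $0$.)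
   Context: All vector spaces are graded, over a fixed field of characteristic zero; $|x|$ is the degree of $x$. For a permutation $\sigma$ of a string of homogeneous elements, $\varepsilon(\sigma)$ is the Koszul sign (a factor $(-1)^{pq}$ whenever elements of degrees $p$ and $q$ are commuted) and $\chi(\sigma)=(-1)^{\sigma}\varepsilon(\sigma)$, where $(-1)^\sigma$ is the sign of $\sigma$. A $(p,n-p)$ unshuffle is $\sigma\in S_n$ with $\sigma(1)<\dots<\sigma(p)$ and $\sigma(p+1)<\dots<\sigma(n)$. A linear map $l:V^{\otimes n}\to V$ has degree $k$ if $l(x_1\otimes\dots\otimes x_n)\in V_N$ with $N=k+\sum|x_i|$; it is skew symmetric if $l(x_{\pi(1)}\otimes\dots\otimes x_{\pi(n)})=\chi(\pi)\,l(x_1\otimes\dots\otimes x_n)$ for all $\pi\in S_n$. Given skew symmetric maps $l_k$, define $\mathcal J_n:V^{\otimes n}\to V$ by $$\mathcal J_n(x_1\otimes\dots\otimes x_n)=\sum_{p=1}^n(-1)^{p(n-p)}\sum_{\sigma\ (p,n-p)\text{ unshuffle}}\chi(\sigma)\,l_{n-p+1}\big(l_p(x_{\sigma(1)}\otimes\dots\otimes x_{\sigma(p)})\otimes x_{\sigma(p+1)}\otimes\dots\otimes x_{\sigma(n)}\big).$$ $V$ is $L_\infty$ (has an $L_\infty$ structure) if the maps $l_k$, $k\ge1$, are skew symmetric, linear, of degree $2-k$, and $\mathcal J_n=0$ for all $n\ge 1$. In the claim, $v,w,x$ have degrees $0,1,2$, and all other graded components of $V$ are zero. The values of $l_r$ on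 permutations of the listed tensors are determined by skew symmetry; $l_r$ vanishes on all other tensors of basis vectors. *)

(* Defs.v *)
From HB Require Import structures.
From mathcomp Require Import all_boot all_order all_algebra all_fingroup.

Set Implicit Arguments.
Unset Strict Implicit.
Unset Printing Implicit Defensive.

Import GRing.Theory.
Local Open Scope ring_scope.

(* A Z-grading, V = \bigoplus_i G i, of a finite-dimensional space, given by
   its homogeneous components. *)
Record grading (F : fieldType) (V : vectType F) := Grading {
  gcomp :> int -> {vspace V};
  grading_direct : forall s : seq int, uniq s ->
    directv (\sum_(i <- s) gcomp i)%VS;
  grading_full : exists s : seq int, (\sum_(i <- s) gcomp i = fullv)%VS
}.

Section Signs.
Variables (F : fieldType) (n : nat).
Implicit Types (s : 'S_n) (d : n.-tuple int).

(* The sign of x_0 ... x_(n-1) |-> x_(s 0) ... x_(s (n-1)) for x_i of degree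
   d_i: the pairs that get commuted are the inversions of s. *)
Definition koszul s d : F :=
  \prod_(i < n) \prod_(j < n | (i < j)%N && (s j < s i)%N)
    (-1) ^ (tnth d (s i) * tnth d (s j)).

Definition chi s d : F := (-1) ^+ s * koszul s d.

(* Positions are numbered from 0: the two blocks are [0, p) and [p, n). *)
Definition unshuffle (p : nat) s : bool :=
  [forall i : 'I_n, forall j : 'I_n,
    (i < j)%N && ((j < p)%N || (p <= i)%N) ==> (s i < s j)%N].

End Signs.

Section Operators.
Variables (F : fieldType) (V : vectType F).

Definition permute n (s : 'S_n) (x : n.-tuple V) : n.-tuple V :=
  [tuple tnth x (s i) | i < n].

Definition subst n (x : n.-tuple V) (i : 'I_n) (u : V) : n.-tuple V :=
  [tuple if j == i then u else tnth x j | j < n].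

(* Linear maps out of the n-th tensor power of V are represented by
   multilinear maps on n-tuples. *)
Definition multilinear n (f : n.-tuple V -> V) : Prop :=
  forall (x : n.-tuple V) (i : 'I_n) (a : F) (u u' : V),
    f (subst x i (a *: u + u')) = a *: f (subst x i u) + f (subst x i u').

Variable G : grading V.

Definition homogeneous n (d : n.-tuple int) (x : n.-tuple V) : Prop :=
  forall i : 'I_n, tnth x i \in G (tnth d i).

Definition has_degree (k : int) n (f : n.-tuple V -> V) : Prop :=
  forall d x, homogeneous d x -> f x \in G (k + \sum_(i < n) tnth d i).

Definition skew_symmetric n (f : n.-tuple V -> V) : Prop :=
  forall (s : 'S_n) d x, homogeneous d x ->
    f (permute s x) = chi F s d *: f x.

Variable l : forall n, n.-tuple V -> V.

(* The Jacobi expression J_n(x) for x_i of degree d_i.  The inner l has arity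
   minn p n = p, the outer one (n - p).+1. *)
Definition jacobi n (d : n.-tuple int) (x : n.-tuple V) : V :=
  \sum_(1 <= p < n.+1) (-1) ^+ (p * (n - p)) *:
    \sum_(s : 'S_n | unshuffle p s) chi F s d *:
      l [tuple of l [tuple of take p (permute s x)] :: drop p (permute s x)].

(* The value of l at arity 0 plays no role. *)
Definition graded_operators : Prop :=
  forall n, (0 < n)%N ->
    [/\ multilinear (@l n), skew_symmetric (@l n)
      & has_degree (2 - n%:Z) (@l n)].

(* J_n is determined by its values on homogeneous tensors. *)
Definition Linfty : Prop :=
  graded_operators /\
  forall n, (0 < n)%N -> forall d x, homogeneous d x -> @jacobi n d x = 0.

End Operators.

(* Main.v *)
Require Import Defs.
From HB Require Import structures.
From mathcomp Require Import all_boot all_order all_algebra all_fingroup ring zify.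
From Stdlib Require Import Classical.

Set Implicit Arguments.
Unset Strict Implicit.
Unset Printing Implicit Defensive.

Import Order.TTheory GRing.Theory Num.Theory.
Local Open Scope ring_scope.

(** The Jacobi identity has to be tested on homogeneous tensors only, and by
    multilinearity on tensors of the basis vectors v, w, x.  On such a tensor
    the Jacobi expression J_n has degree 3 - n + sum_i d_i, that is, 3 minus the
    number of v's plus the number of x's, and V lives in degrees 0, 1, 2.
    So J_n vanishes for degree reasons unless there are more v's than x's.  It
    also vanishes when v occurs twice, because J_n is itself skew symmetric and
    v has even degree ([jacobi_repeat]; this uses 2 <> 0).  The only tensors
    left consist of one v and n - 1 w's.

    On those, each summand of J_n depends only on whether v goes to the inner or
    to the outer operation, and there are C(n-1, p-1), resp. C(n-1, p),
    unshuffles of either kind, so that up to an overall sign J_n is E_n x with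
      E_n = sum_(p=1..n) (-1)^(p(n-p)) b_(n-p+1)
              (C(n-1, p-1) a_p - C(n-1, p-2) c_p)
    ([jacobi_single_v]).  Being L-infinity thus means E_n = 0 for all n >= 1.
    If some b_p is nonzero, let b_k be the first such.  Then E_n = 0 trivially
    for n < k, and in E_(m+k-1) only the terms p <= m survive; the last of them
    contains a_m with the invertible coefficient C(m+k-2, m-1) b_k, so
    E_(m+k-1) = 0 can be solved for a_m ([jacobi_coef_solve]).  The first
    equation, m = 1, says a_1 = 0, which is why the sum may start at p = 2.

    Signs are handled by working with words of labels, that is, sequences of
    indices of the tensor factors: chi is a product over the inversions of a
    word ([chi_word_sign]), so exchanging two neighbours i, j in a word
    multiplies it by -(-1)^(d_i d_j), which is exactly the factor by which a
    skew symmetric operation changes.  Every invariance statement below is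
    reduced to such a single exchange. *)

(** * Words up to exchange of neighbours *)

(** Adjacent transpositions generate all rearrangements.  Restricting to
    distinct neighbours lets [f] involve the sign of an exchange, whose formula
    is wrong when both letters coincide. *)
Lemma perm_eq_swap_ind (T : eqType) (R : Type) (f : seq T -> R) :
    (forall s1 s2 a b, a != b -> f (s1 ++ a :: b :: s2) = f (s1 ++ b :: a :: s2)) ->
  forall s t, perm_eq s t -> f s = f t.
Proof.
move=> f_swap s; elim: s => [|a s IHs] in f f_swap *.
  by move=> t; rewrite perm_sym => /perm_nilP->.
move=> t st; have /splitPr t_a: a \in t by rewrite -(perm_mem st) mem_head.
case: t_a st => t1 t2 st.
have{} st: perm_eq s (t1 ++ t2).
  by rewrite -(perm_cons a) (permPl st) perm_catC /= perm_cons perm_catC.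
have {IHs} /= -> := IHs (f \o cons a) (fun s1 => f_swap (a :: s1)) _ st; clear st.
elim/last_ind: t1 t2 => [|t1 b IHt] t2 //=; rewrite !cat_rcons.
rewrite (IHt (b :: t2)); have [->//|ab] := eqVneq a b; exact: f_swap.
Qed.

(** * The sign of a word of labels *)

Section WordSign.
Variables (F : fieldType) (n : nat).
Implicit Types (d : n.-tuple int) (t : seq 'I_n).

(** The factor that both [chi] and a skew symmetric operation pick up when two
    neighbours labelled [i] and [j] are exchanged. *)
Definition swap_sign d (i j : 'I_n) : F := - (-1) ^ (tnth d i * tnth d j).

Fixpoint word_sign d t : F :=
  if t is i :: t' then
    \prod_(j <- t' | (j < i)%N) swap_sign d i j * word_sign d t'
  else 1.

Lemma expN1_sqr (z : int) : (-1 : F) ^ z * (-1) ^ z = 1.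
Proof.
case: z => k; first by rewrite -expr2 sqrr_sign.
by rewrite -[_ ^ _]/((-1) ^- k.+1) invr_sign -expr2 sqrr_sign.
Qed.

Lemma swap_signC d i j : swap_sign d i j = swap_sign d j i.
Proof. by rewrite /swap_sign mulrC. Qed.

Lemma swap_sign_sqr d i j : swap_sign d i j * swap_sign d i j = 1.
Proof. by rewrite mulrNN expN1_sqr. Qed.

Lemma word_sign_swap d s1 s2 i j : i != j ->
  word_sign d (s1 ++ i :: j :: s2)
    = swap_sign d i j * word_sign d (s1 ++ j :: i :: s2).
Proof.
move=> ij; elim: s1 => [|k s1 IHs] /=; last first.
  rewrite IHs mulrCA; congr (_ * (_ * _)).
  apply: perm_big; rewrite perm_cat2l -![_ :: _ :: s2]/([:: _; _] ++ s2).
  by rewrite perm_cat2r (perm_catC [:: i]).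
rewrite !big_cons; case: ltngtP ij => [lt_ji|lt_ij|/val_inj->] ; rewrite ?eqxx // => _.
  by rewrite -!mulrA; congr (_ * _); rewrite mulrCA.
by rewrite (swap_signC d j) !mulrA swap_sign_sqr mul1r; congr (_ * _); exact: mulrC.
Qed.

Lemma word_sign_sqr d t : word_sign d t * word_sign d t = 1.
Proof.
elim: t => [|i t IHt] /=; first by rewrite mulr1.
rewrite mulrACA IHt mulr1 -big_split big1 //= => j _; exact: swap_sign_sqr.
Qed.

Lemma word_sign_map d m (f : 'I_m -> 'I_n) :
  word_sign d (map f (enum 'I_m)) =
  \prod_(i < m) \prod_(j < m | (i < j)%N && (f j < f i)%N) swap_sign d (f i) (f j).
Proof.
elim: m => [|m IHm] in f *; first by rewrite big_ord0 enum_ord0.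
rewrite enum_ordSl /= -map_comp IHm big_ord_recl; congr (_ * _).
  rewrite big_map big_enum_cond big_mkcond [in RHS]big_mkcond big_ord_recl /=.
  by rewrite mul1r.
apply: eq_bigr => i _; rewrite [in RHS]big_mkcond big_ord_recl /= mul1r.
by rewrite -big_mkcond.
Qed.

(** Permuting the entries of the integer Vandermonde determinant with nodes
    0, ..., n-1 multiplies it by the sign of the permutation, while the product
    formula shows that its sign changes once per inversion. *)
Lemma odd_perm_inversions (s : 'S_n) :
  (-1) ^+ s = \prod_(i < n) \prod_(j < n | (i < j)%N && (s j < s i)%N) (-1 : F).
Proof.
pose inv := \prod_(i < n) \prod_(j < n | (i < j)%N && (s j < s i)%N) (-1 : int).
suff sE : (-1) ^+ s = inv.
  have := congr1 (fun z : int => z%:~R : F) sE.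
  rewrite rmorphXn /= rmorphN1 => ->; rewrite rmorph_prod; apply: eq_bigr => i _.
  by rewrite rmorph_prod; apply: eq_bigr => j _; rewrite rmorphN1.
pose a (g : 'I_n -> 'I_n) : 'rV[int]_n := \row_i (g i : nat)%:Z.
have detE : \det (Vandermonde n (a s)) = (-1) ^+ s * \det (Vandermonde n (a id)).
  suff -> : Vandermonde n (a s) = col_perm s (Vandermonde n (a id)).
    by rewrite col_permE det_mulmx det_perm odd_permV mulrC.
  by apply/matrixP=> i j; rewrite !mxE.
have := congr1 Num.sg detE; rewrite !det_Vandermonde sgrM.
have -> : Num.sg (\prod_(i < n) \prod_(j < n | (i < j)%N) (a id 0 j - a id 0 i)) = 1.
  apply/gtr0_sg/prodr_gt0 => i _; apply: prodr_gt0 => j ij.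
  by rewrite !mxE subr_gt0 ltz_nat.
rewrite mulr1 => sgE; transitivity (Num.sg ((-1) ^+ s : int)).
  by case: (s : bool).
rewrite -sgE (big_morph Num.sg (@sgrM int) (@sgr1 int)).
apply: eq_bigr => i _; rewrite (big_morph Num.sg (@sgrM int) (@sgr1 int)).
rewrite big_mkcondr /=; apply: eq_bigr => j ij; rewrite !mxE.
case: ltngtP => [lt_ji|lt_ij|/val_inj/perm_inj eq_ji].
- by rewrite ltr0_sg // subr_lt0 ltz_nat.
- by rewrite gtr0_sg // subr_gt0 ltz_nat.
- by rewrite eq_ji ltnn in ij.
Qed.

Lemma chi_word_sign (s : 'S_n) d : chi F s d = word_sign d (codom s).
Proof.
rewrite codomE word_sign_map /chi /koszul odd_perm_inversions -big_split /=.
apply: eq_bigr => i _; rewrite -big_split; apply: eq_bigr => j _.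
exact: mulN1r.
Qed.

Lemma word_sign_enum d : word_sign d (enum 'I_n) = 1.
Proof.
rewrite -[enum _]map_id word_sign_map big1 // => i _.
by rewrite big1 // => j /andP[/ltnW]; rewrite leqNgt => /negP.
Qed.

(** Relabelling along a permutation that preserves degrees commutes with
    exchanges of neighbours, so the ratio of the signs before and after does
    not depend on the word and may be computed on the increasing one. *)
Lemma word_sign_relabel d (s : 'S_n) t :
    (forall i, tnth d (s i) = tnth d i) -> perm_eq t (enum 'I_n) ->
  word_sign d (map s t) = chi F s d * word_sign d t.
Proof.
move=> ds t_enum.
(* Signs are their own inverses, so this product is the ratio. *)
pose f u := word_sign d (map s u) * word_sign d u.
suff fE : f t = chi F s d.
  by rewrite -fE -mulrA word_sign_sqr mulr1.
rewrite (perm_eq_swap_ind _ t_enum) /f.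
  by rewrite word_sign_enum mulr1 chi_word_sign.
move=> s1 s2 i j ij; rewrite !map_cat /= (word_sign_swap d s1 s2 ij).
have sij : s i != s j by rewrite (inj_eq perm_inj).
rewrite (word_sign_swap d (map s s1) (map s s2) sij).
by rewrite mulrACA /swap_sign !ds swap_sign_sqr mul1r.
Qed.

Lemma perm_word t : perm_eq t (enum 'I_n) -> exists s : 'S_n, t = codom s.
Proof.
move=> tE; have sz : size t == n by rewrite (perm_size tE) size_enum_ord.
have /tuple_uniqP t_inj : uniq (Tuple sz) by rewrite (perm_uniq tE) enum_uniq.
exists (perm t_inj); rewrite codomE -[LHS]/(tval (Tuple sz)) -map_tnth_enum.
by apply: eq_map => i; rewrite permE.
Qed.

(** Every inversion of a transposition involves one of the two exchanged labels,
    of degree 0, so the Koszul sign is trivial. *)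
Lemma chi_tperm_degree0 d i j : i != j -> tnth d i = 0 -> tnth d j = 0 ->
  chi F (tperm i j) d = -1.
Proof.
move=> ij di dj; rewrite /chi odd_tperm ij /koszul big1 ?mulr1 // => k _.
apply: big1 => m /andP[km].
case: (tpermP i j k) => [_|_|_ _]; case: (tpermP i j m) => [_|_|_ _] mk;
  rewrite ?di ?dj ?mul0r ?mulr0 ?expr0z //.
by move: (ltn_trans km mk); rewrite ltnn.
Qed.

End WordSign.

(** * Unshuffles as subsets *)

Section Unshuffles.
Variable n : nat.
Implicit Types (s : 'S_n) (A : {set 'I_n}).

Definition first_block p s : {set 'I_n} := [set i in take p (codom s)].

Definition set_word A : seq 'I_n := enum A ++ enum (~: A).

Lemma set_word_perm A : perm_eq (set_word A) (enum 'I_n).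
Proof.
apply: uniq_perm => [||i]; rewrite ?enum_uniq //.
  rewrite cat_uniq !enum_uniq andbT /=; apply/hasPn => i.
  by rewrite !mem_enum inE.
by rewrite mem_cat !mem_enum inE orbN.
Qed.

Lemma sorted_enum_set A : sorted (fun i j : 'I_n => (i < j)%N) (enum A).
Proof.
rewrite /enum_mem -enumT; apply: sorted_filter => [i j k|]; first exact: ltn_trans.
by have := iota_ltn_sorted 0 n; rewrite -val_enum_ord sorted_map.
Qed.

Lemma size_codom_ord s : size (codom s) = n.
Proof. by rewrite size_codom card_ord. Qed.

Lemma nth_codom_ord s (i j : 'I_n) : nth i (codom s) j = s j.
Proof. by rewrite codomE (nth_map i) ?size_enum_ord // nth_ord_enum. Qed.

(** Both blocks of an unshuffle are increasing, and an increasing word is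
    determined by its set of letters. *)
Lemma unshuffle_codom p s : (p <= n)%N -> unshuffle p s ->
  codom s = set_word (first_block p s).
Proof.
move=> le_pn /forallP s_incr.
have {}s_incr (i j : 'I_n) : (i < j)%N -> (j < p)%N || (p <= i)%N -> (s i < s j)%N.
  by move=> ij pij; have /forallP/(_ j) := s_incr i; rewrite ij pij.
have nthE (i0 : 'I_n) i (lt_i : (i < n)%N) :
    nth i0 (codom s) i = s (Ordinal lt_i).
  rewrite (set_nth_default (Ordinal lt_i)) ?size_codom_ord //.
  exact: (nth_codom_ord _ _ (Ordinal lt_i)).
have codom_cat := cat_take_drop p (codom s).
have codom_uniq : uniq (codom s) by apply/injectiveP; exact: perm_inj.
have codom_full i : i \in codom s by rewrite -[i](permKV s) codom_f.
have ltn_irr : irreflexive (fun i j : 'I_n => (i < j)%N) by move=> i; rewrite ltnn.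
have ltn_tr : transitive (fun i j : 'I_n => (i < j)%N).
  by move=> i j k; exact: ltn_trans.
rewrite -{1}codom_cat; congr (_ ++ _); apply: (irr_sorted_eq ltn_tr ltn_irr);
    rewrite ?sorted_enum_set //.
- case E: {1}(take _ _) => [|i0 t] //; rewrite -E; apply/(sortedP i0) => i.
  rewrite size_takel ?size_codom_ord // => lt_i1.
  rewrite !nth_take ?(ltnW lt_i1) //.
  have lt_i1n := leq_trans lt_i1 le_pn.
  by rewrite (nthE _ _ (ltnW lt_i1n)) (nthE _ _ lt_i1n) s_incr //= lt_i1.
- by move=> i; rewrite mem_enum inE.
- case E: {1}(drop _ _) => [|i0 t] //; rewrite -E; apply/(sortedP i0) => i.
  rewrite size_drop size_codom_ord ltn_subRL => lt_i1; rewrite !nth_drop.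
  have lt_in : (p + i < n)%N by apply: leq_trans lt_i1; rewrite ltnS leq_add2l.
  rewrite (nthE _ _ lt_in) (nthE _ _ lt_i1) s_incr //=.
    by rewrite addnS.
  by rewrite leq_addr orbT.
- move=> i; rewrite mem_enum !inE; have := codom_full i; move: codom_uniq.
  rewrite -{1 2}codom_cat cat_uniq mem_cat => /and3P[_ /hasPn dis _].
  by case: (boolP (i \in drop _ _)) => [/dis->//|_]; rewrite orbF => ->.
Qed.

Lemma set_word_unshuffle A s : codom s = set_word A -> unshuffle #|A| s.
Proof.
move=> sE; apply/forallP=> i; apply/forallP=> j; apply/implyP=> /andP[ij].
have ltn_tr : transitive (fun i j : 'I_n => (i < j)%N).
  by move=> i' j' k; exact: ltn_trans.
have sz := size_codom_ord s; rewrite sE size_cat -cardE in sz.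
rewrite -(nth_codom_ord s i i) -(nth_codom_ord s i j) sE !nth_cat -cardE.
case/orP=> [lt_j|le_i].
  rewrite lt_j (ltn_trans ij lt_j).
  apply: (sorted_ltn_nth ltn_tr i (sorted_enum_set A)) (ij); rewrite inE -cardE //.
  exact: ltn_trans lt_j.
have le_j := leq_trans le_i (ltnW ij).
rewrite [(i < _)%N]ltnNge [(j < _)%N]ltnNge le_i le_j /=.
apply: (sorted_ltn_nth ltn_tr i (sorted_enum_set (~: A))); last first.
  by rewrite ltn_sub2r // (leq_ltn_trans le_i).
all: by rewrite inE -(ltn_add2l #|A|) subnKC // sz.
Qed.

(** Indexing by subsets rather than unshuffles makes available permutations of
    the labels (which act on subsets) and the count of subsets by cardinal. *)
Lemma sum_unshuffle (W : nmodType) p (f : seq 'I_n -> seq 'I_n -> W) :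
    (p <= n)%N ->
  \sum_(s | unshuffle p s) f (take p (codom s)) (drop p (codom s))
    = \sum_(A : {set 'I_n} | #|A| == p) f (enum A) (enum (~: A)).
Proof.
move=> le_pn; have /fin_all_exists[g gE] A := perm_word (set_word_perm A).
have take_g A : take #|A| (codom (g A)) = enum A.
  by rewrite -gE cardE take_size_cat.
have drop_g A : drop #|A| (codom (g A)) = enum (~: A).
  by rewrite -gE cardE drop_size_cat.
have codom_inj s s' : codom s = codom s' -> s = s'.
  by move=> ss'; apply/permP => i; rewrite -!(nth_codom_ord _ i) ss'.
rewrite (reindex_onto g (first_block p)) => [|s s_unsh]; last first.
  by apply: codom_inj; rewrite -gE -unshuffle_codom.
have card_g A : unshuffle p (g A) && (first_block p (g A) == A) = (#|A| == p).
  apply/idP/eqP=> [/andP[_ /eqP AE]|<-].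
    rewrite -[in LHS]AE /first_block cardsE (card_uniqP _).
      by rewrite size_takel ?size_codom_ord.
    by rewrite take_uniq //; apply/injectiveP; exact: perm_inj.
  rewrite set_word_unshuffle -?gE //=.
  by apply/eqP/setP=> i; rewrite inE take_g mem_enum.
apply: eq_big => [A|A]; rewrite card_g // => /eqP <-.
by rewrite take_g drop_g.
Qed.

End Unshuffles.

(** * Skew symmetric operations on words of vectors *)

Section Operators.
Variables (F : fieldType) (V : vectType F) (G : grading V).
Variable l : forall n, n.-tuple V -> V.

(** Forgetting the arity lets the arguments be rearranged and split as sequences,
    without casts between tuple types. *)
Definition lseq (s : seq V) : V := l (in_tuple s).

Lemma lseqE n (t : n.-tuple V) : l t = lseq t.
Proof.
case: t => s sz; case: _ / (eqP sz) (sz) => sz'.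
by rewrite /lseq; congr l; exact: val_inj.
Qed.

Hypothesis l_ops : graded_operators G l.

Lemma tval_subst s1 s2 (u u' : V) (i : 'I_(size (s1 ++ u :: s2))) :
  i = size s1 :> nat -> subst (in_tuple (s1 ++ u :: s2)) i u' = s1 ++ u' :: s2 :> seq V.
Proof.
move=> iE; apply: (@eq_from_nth _ 0) => [|j]; first by rewrite size_tuple !size_cat.
rewrite size_tuple => lt_j; pose jj := Ordinal lt_j.
rewrite -[j]/(val jj) -tnth_nth tnth_mktuple (tnth_nth 0) -val_eqE /= iE !nth_cat.
case: ltngtP => // [gt_j|->]; last by rewrite subnn.
by rewrite -(subnSK gt_j).
Qed.

Lemma lseqZ s1 k u s2 : lseq (s1 ++ k *: u :: s2) = k *: lseq (s1 ++ u :: s2).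
Proof.
have lt_i : (size s1 < size (s1 ++ u :: s2))%N.
  by rewrite size_cat /= addnS ltnS leq_addr.
have [lin _ _] := l_ops (leq_ltn_trans (leq0n _) lt_i).
pose f u' := lseq (s1 ++ u' :: s2).
have {}lin a u1 u2 : f (a *: u1 + u2) = a *: f u1 + f u2.
  have := lin (in_tuple (s1 ++ u :: s2)) (Ordinal lt_i) a u1 u2.
  by rewrite !lseqE !tval_subst.
have f0 : f 0 = 0 by have := lin (-1) 0 0; rewrite scaleN1r oppr0 addr0 scaleN1r addNr.
by have := lin k u 0; rewrite f0 !addr0.
Qed.

Lemma lseq_scale n (k : 'I_n -> F) (e : 'I_n -> V) s t :
  lseq (s ++ [seq k i *: e i | i <- t])
    = (\prod_(i <- t) k i) *: lseq (s ++ map e t).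
Proof.
elim: t s => [|i t IHt] s /=; first by rewrite big_nil scale1r.
by rewrite lseqZ -cat_rcons IHt cat_rcons scalerA big_cons.
Qed.

Definition graded_word (s : seq V) (d : seq int) : bool :=
  all2 (fun u z => u \in G z) s d.

Lemma graded_word_tuple s d (sz : size d == size s) :
  graded_word s d -> homogeneous G (Tuple sz) (in_tuple s).
Proof.
rewrite /graded_word all2E => /andP[/eqP szE /allP sd] i.
have := sd (tnth (in_tuple s) i, tnth (Tuple sz) i); apply.
rewrite (tnth_nth 0) (tnth_nth 0) /= -nth_zip //.
by rewrite mem_nth // size_zip -szE minnn.
Qed.

Lemma lseq_degree s d : (0 < size s)%N -> graded_word s d ->
  lseq s \in G (2 - (size s)%:Z + \sum_(z <- d) z).
Proof.
move=> s_gt0 sd; have sz : size d == size s.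
  by move: sd; rewrite /graded_word all2E eq_sym => /andP[].
have [_ _ deg] := l_ops s_gt0.
have := deg _ _ (graded_word_tuple sz sd).
by rewrite -(big_tuple _ _ (Tuple sz) xpredT id).
Qed.

(** Skew symmetry in terms of words: the sign of a rearrangement is the sign of
    the word of labels that describes it. *)
Lemma lseq_codom n (d : n.-tuple int) (x : n.-tuple V) (s : 'S_n) :
    (0 < n)%N -> homogeneous G d x ->
  lseq (map (tnth x) (codom s)) = word_sign F d (codom s) *: lseq x.
Proof.
move=> n_gt0 dx; have [_ skew _] := l_ops n_gt0.
rewrite -chi_word_sign -lseqE -(skew s d x dx) lseqE; congr lseq.
by rewrite codomE -map_comp.
Qed.

(** Obtained from [lseq_codom] for the labels 0, 1, ... with two neighbours
    exchanged: its word sign is one [swap_sign] times that of the increasing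
    word, which is 1. *)
Lemma lseq_swap s1 s2 ds1 ds2 u u' z z' :
    graded_word s1 ds1 -> graded_word s2 ds2 -> u \in G z -> u' \in G z' ->
  lseq (s1 ++ u :: u' :: s2) = - (-1) ^ (z * z') *: lseq (s1 ++ u' :: u :: s2).
Proof.
move=> sd1 sd2 uz uz'; set s := s1 ++ u' :: u :: s2.
pose d := ds1 ++ z' :: z :: ds2.
have sd : graded_word s d.
  move: sd1 sd2; rewrite /graded_word !all2E => /andP[/eqP sz1 a1] /andP[/eqP sz2 a2].
  by rewrite !size_cat /= sz1 sz2 eqxx zip_cat // all_cat a1 /= uz uz'.
have sz : size d == size s.
  by move: sd; rewrite /graded_word all2E eq_sym => /andP[].
have dx := graded_word_tuple sz sd.
have enumE := map_tnth_enum (in_tuple s).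
have enumdE := map_tnth_enum (Tuple sz).
pose e := enum 'I_(size s); rewrite -/e in enumE enumdE.
have lt1 : ((size s1).+1 < size e)%N.
  by rewrite size_enum_ord /s size_cat /= !addnS !ltnS leq_addr.
have := cat_take_drop (size s1) e; case E: (drop _ e) => [|i [|j e2]].
- move: lt1; rewrite -(cat_take_drop (size s1) e) E cats0 size_take_min.
  by rewrite ltnNge geq_min leqnSn.
- move: lt1; rewrite -(cat_take_drop (size s1) e) E size_cat addn1 size_take_min.
  by rewrite ltnS ltnNge geq_minl.
set e1 := take _ e => eE; have sz1 : size e1 = size s1.
  by rewrite size_takel // ltnW // ltnW.
move: enumE; rewrite -eE map_cat /s => /eqP; rewrite eqseq_cat ?size_map //=.
case/andP=> /eqP s1E /eqP[iE jE s2E].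
move: enumdE; rewrite -eE map_cat /d => /eqP.
rewrite eqseq_cat ?size_map //=; last first.
  by move: sd1; rewrite /graded_word all2E sz1 => /andP[/eqP].
case/andP=> _ /eqP[diE djE _].
have eP : perm_eq (e1 ++ j :: i :: e2) e.
  rewrite -eE perm_cat2l -![_ :: _ :: e2]/([:: _; _] ++ e2).
  by rewrite perm_cat2r (perm_catC [:: j]).
have ij : j != i.
  have := enum_uniq 'I_(size s); rewrite -/e -(perm_uniq eP) cat_uniq /=.
  by case/and4P=> _ _; rewrite inE negb_or => /andP[].
have [t tE] := perm_word eP.
have := lseq_codom t (leq_ltn_trans (leq0n _) (ltn_ord i)) dx.
rewrite -tE word_sign_swap // eE word_sign_enum mulr1 /swap_sign diE djE.
by rewrite map_cat /= s1E iE jE s2E.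
Qed.

(** * The Jacobi expression as a sum over subsets *)

Section Nested.
Variables (n : nat) (d : n.-tuple int).
Implicit Types (e : 'I_n -> V) (t : seq 'I_n) (A : {set 'I_n}).

(** One summand of the Jacobi expression, [t1] being the labels of the arguments
    of the inner operation and [t2] the remaining ones. *)
Definition nested e t1 t2 : V :=
  word_sign F d (t1 ++ t2) *: lseq (lseq (map e t1) :: map e t2).

Lemma jacobiE (x : n.-tuple V) :
  jacobi l d x = \sum_(1 <= p < n.+1) (-1) ^+ (p * (n - p)) *:
    \sum_(A : {set 'I_n} | #|A| == p) nested (tnth x) (enum A) (enum (~: A)).
Proof.
apply: eq_big_nat => p /andP[_ le_pn]; congr (_ *: _).
rewrite -(sum_unshuffle (nested (tnth x))) //; apply: eq_bigr => s _.
rewrite chi_word_sign !lseqE /nested cat_take_drop /=.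
by rewrite (map_comp (tnth x) s) -codomE map_take map_drop.
Qed.

Lemma nested_scale (k : 'I_n -> F) e A :
  nested (fun i => k i *: e i) (enum A) (enum (~: A))
    = (\prod_i k i) *: nested e (enum A) (enum (~: A)).
Proof.
rewrite /nested (lseq_scale k e [::]) (lseqZ [::]) (lseq_scale k e [:: _]).
rewrite !scalerA -mulrA -big_cat (perm_big _ (set_word_perm A)) /=.
by rewrite big_enum mulrC.
Qed.

Variable e : 'I_n -> V.
Hypothesis de : forall i, e i \in G (tnth d i).

Lemma graded_word_map t : graded_word (map e t) (map (tnth d) t).
Proof. by elim: t => //= i t ->; rewrite de. Qed.

Lemma lseq_map_degree t : (0 < size t)%N ->
  lseq (map e t) \in G (2 - (size t)%:Z + \sum_(i <- t) tnth d i).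
Proof.
move=> t_gt0; have := lseq_degree _ (graded_word_map t).
by rewrite size_map big_map; apply.
Qed.

(** Exchanging neighbours inside either block changes the word sign and the
    value of the corresponding operation by the same sign.  This is why a
    summand depends only on the subset that the unshuffle selects. *)
Lemma nested_perm t1 t1' t2 t2' : (0 < size t1)%N ->
  perm_eq t1 t1' -> perm_eq t2 t2' -> nested e t1 t2 = nested e t1' t2'.
Proof.
move=> t1_gt0 pt1 pt2; transitivity (nested e t1' t2).
  apply: (perm_eq_swap_ind (f := fun t => nested e t t2)) pt1 => s1 s2 i j ij.
  rewrite /nested -!catA /= word_sign_swap // !map_cat /=.
  rewrite (lseq_swap (graded_word_map s1) (graded_word_map s2) (de i) (de j)).
  rewrite (lseqZ [::]) scalerA mulrAC /swap_sign.
  by rewrite mulrNN expN1_sqr mul1r.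
have {t1_gt0 pt1} t1'_gt0 : (0 < size t1')%N by rewrite -(perm_size pt1).
apply: (perm_eq_swap_ind (f := nested e t1')) pt2 => s1 s2 i j ij.
rewrite /nested !catA word_sign_swap // !map_cat /= -!cat_cons.
have s1_deg : graded_word (lseq (map e t1') :: map e s1)
    ((2 - (size t1')%:Z + \sum_(i <- t1') tnth d i) :: map (tnth d) s1).
  by apply/andP; split; [exact: lseq_map_degree | exact: graded_word_map].
rewrite (lseq_swap s1_deg (graded_word_map s2) (de i) (de j)).
by rewrite scalerA mulrAC /swap_sign mulrNN expN1_sqr mul1r.
Qed.

Lemma nested_degree A : (0 < #|A|)%N ->
  nested e (enum A) (enum (~: A)) \in G (3 - n%:Z + \sum_i tnth d i).
Proof.
move=> A_gt0; apply: memvZ.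
have A_size : (0 < size (enum A))%N by rewrite -cardE.
set z := 2 - (size (enum A))%:Z + \sum_(i <- enum A) tnth d i.
have word_deg : graded_word (lseq (map e (enum A)) :: map e (enum (~: A)))
    (z :: map (tnth d) (enum (~: A))).
  by apply/andP; split; [exact: lseq_map_degree | exact: graded_word_map].
have := lseq_degree (s := _ :: _) isT word_deg; rewrite big_cons big_map /= size_map.
set z' := (X in lseq _ \in G X); suff -> : 3 - n%:Z + \sum_i tnth d i = z' by [].
have -> : \sum_i tnth d i
    = \sum_(i <- enum A) tnth d i + \sum_(i <- enum (~: A)) tnth d i.
  by rewrite -big_cat (perm_big _ (set_word_perm A)) big_enum.
have -> : n%:Z = (size (enum A))%:Z + (size (enum (~: A)))%:Z.
  by rewrite -PoszD -!cardE cardsC card_ord.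
by rewrite /z' /z -[(size _).+1]addn1 PoszD; ring.
Qed.

(** The transposition of two equal arguments of degree 0 does not change the
    arguments, and multiplies the word sign by -1. *)
Lemma nested_tperm i j A : i != j -> tnth d i = 0 -> tnth d j = 0 -> e i = e j ->
    (0 < #|A|)%N ->
  nested e (enum (tperm i j @: A)) (enum (~: (tperm i j @: A)))
    = - nested e (enum A) (enum (~: A)).
Proof.
move=> ij di dj eij A_gt0; set t := tperm i j.
have enum_imset (B : {set 'I_n}) : perm_eq (enum (t @: B)) (map t (enum B)).
  apply: uniq_perm => [||k]; rewrite ?map_inj_uniq ?enum_uniq //; first exact: perm_inj.
  rewrite mem_enum; apply/imsetP/mapP => -[m Bm ->]; exists m => //.
    by rewrite mem_enum.
  by rewrite mem_enum in Bm.
have tC : ~: (t @: A) = t @: (~: A).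
  apply/setP=> k; rewrite -[k](permKV t) inE !mem_imset ?inE //; exact: perm_inj.
rewrite tC (nested_perm _ (enum_imset _) (enum_imset _)); last first.
  by rewrite -cardE card_imset //; exact: perm_inj.
have et k : e (t k) = e k by rewrite /t; case: tpermP => // ->.
have dt k : tnth d (t k) = tnth d k by rewrite /t; case: tpermP => // ->; rewrite di dj.
rewrite /nested -!map_comp -map_cat word_sign_relabel ?set_word_perm //.
rewrite chi_tperm_degree0 // mulN1r scaleNr; congr (- (_ *: lseq (lseq _ :: _))).
  exact: eq_map.
exact: eq_map.
Qed.

End Nested.

Lemma jacobi_scale n (d : n.-tuple int) (k : 'I_n -> F) (x y : n.-tuple V) :
  (forall i, tnth x i = k i *: tnth y i) ->
  jacobi l d x = (\prod_i k i) *: jacobi l d y.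
Proof.
move=> xy; rewrite !jacobiE scaler_sumr; apply: eq_bigr => p _.
rewrite scalerA mulrC -scalerA; congr (_ *: _); rewrite scaler_sumr.
apply: eq_bigr => A _; rewrite -nested_scale /nested.
by rewrite !(eq_map xy).
Qed.

Lemma jacobi_degree n (d : n.-tuple int) x : homogeneous G d x ->
  jacobi l d x \in G (3 - n%:Z + \sum_i tnth d i).
Proof.
move=> dx; rewrite jacobiE big_nat; apply: memv_suml => p /andP[p_gt0 _].
apply: memvZ; apply: memv_suml => A /eqP Ap; apply: nested_degree => //.
by rewrite Ap.
Qed.

(** The summands of [A] and of its image under the transposition of [i] and [j]
    are opposite, so the sum over all subsets equals its own opposite. *)
Lemma jacobi_repeat (char2 : 2%:R != 0 :> F) n (d : n.-tuple int) x i j :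
    homogeneous G d x -> i != j -> tnth d i = 0 -> tnth d j = 0 ->
    tnth x i = tnth x j ->
  jacobi l d x = 0.
Proof.
move=> dx ij di dj xij; rewrite jacobiE big_nat big1 // => p /andP[p_gt0 _].
set S := \sum_(A | _) _; suff SN : S = - S.
  suff -> : S = 0 by rewrite scaler0.
  have : 2%:R *: S == 0 by rewrite scaler_nat mulr2n {1}SN addNr.
  by rewrite scaler_eq0 (negPf char2) => /eqP.
rewrite {1}/S (reindex_inj (imset_inj (@perm_inj _ (tperm i j)))) /= -sumrN.
apply: eq_big => [A|A]; rewrite card_imset ?(inj_eq perm_inj) //; try exact: perm_inj.
move=> /eqP Ap; apply: nested_tperm => //; by rewrite Ap.
Qed.

End Operators.

(** * Tensors with a single v *)

(** The p-subsets that avoid [i] are the p-subsets of an (n-1)-element set; the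
    others are counted by subtraction and the Pascal rule. *)
Lemma sum_sets_mem (F : pzRingType) n (i : 'I_n) p (f : bool -> F) : (0 < p)%N ->
  \sum_(A : {set 'I_n} | #|A| == p) f (i \in A)
    = 'C(n - 1, p - 1)%:R * f true + 'C(n - 1, p)%:R * f false.
Proof.
move=> p_gt0.
have outC : #|[set A : {set 'I_n} | #|A| == p & i \notin A]| = 'C(n - 1, p).
  transitivity #|[set A : {set 'I_n} | A \subset ~: [set i] & #|A| == p]|.
    apply: eq_card => A; rewrite !inE andbC; congr (_ && _).
    by rewrite subsetC sub1set inE.
  by rewrite cards_draws cardsC1 card_ord subn1.
have inC : #|[set A : {set 'I_n} | #|A| == p & i \in A]| = 'C(n - 1, p - 1).
  have all_p : #|[set A : {set 'I_n} | #|A| == p]| = 'C(n, p).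
    by rewrite card_draws card_ord.
  apply: (@addIn 'C(n - 1, p)); rewrite -{1}outC; move: all_p.
  rewrite -(cardsID [set A : {set 'I_n} | i \in A]) => sumE.
  transitivity 'C(n, p).
    by rewrite -sumE; congr (_ + _)%N; apply: eq_card => A; rewrite !inE // andbC.
  by case: n i p p_gt0 {outC sumE} => [[]//|n] _ [|p] // _; rewrite !subSS !subn0 addnC.
rewrite (bigID (fun A : {set 'I_n} => i \in A)) /=; congr (_ + _).
  rewrite (eq_bigr (fun=> f true)) => [|A /andP[_ ->] //].
  by rewrite sumr_const mulr_natl -inC cardsE.
rewrite (eq_bigr (fun=> f false)) => [|A /andP[_ /negPf->] //].
by rewrite sumr_const mulr_natl -outC cardsE.
Qed.

Section ThreeDimensional.
Variables (F : fieldType) (V : vectType F) (G : grading V) (v w x : V).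
Hypotheses (Gv : v \in G 0) (Gw : w \in G 1) (Gx : x \in G 2).
Variables (a b c : nat -> F) (l : forall r : nat, r.-tuple V -> V).
Hypothesis l_ops : graded_operators G l.
Hypothesis l_a : forall r, l [tuple of v :: nseq r w] = a r.+1 *: w.
Hypothesis l_b : forall r, l [tuple of nseq r.+1 w] = b r.+1 *: x.
Hypothesis l_c : forall r, l [tuple of v :: rcons (nseq r w) x] = c r.+2 *: x.

Lemma graded_nseq r : graded_word G (nseq r w) (nseq r 1).
Proof. by elim: r => //= r ->; rewrite Gw. Qed.

(** The even x anticommutes with each of the [m] w's on its way to the end. *)
Lemma lseq_x_inside k m :
  lseq l (v :: nseq k w ++ x :: nseq m w)
    = (-1) ^+ m *: lseq l (v :: rcons (nseq (k + m) w) x).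
Proof.
elim: m k => [|m IHm] k; first by rewrite addn0 scale1r cats1.
have v_deg : graded_word G (v :: nseq k w) (0 :: nseq k 1).
  by apply/andP; split=> //; exact: graded_nseq.
rewrite /= -cat_cons (lseq_swap l_ops v_deg (graded_nseq m) Gx Gw).
have -> : (v :: nseq k w) ++ [:: w, x & nseq m w] = v :: nseq k.+1 w ++ x :: nseq m w.
  by rewrite -[in RHS]addn1 nseqD -catA.
rewrite IHm scalerA mulr1 exprS addSnnS; congr (_ *: _).
by rewrite -[(-1) ^ 2]/((-1) ^+ 2) sqrrN expr1n.
Qed.

Lemma lseq_x_first m : lseq l (x :: v :: nseq m w) = ((-1) ^+ m.+1 * c m.+2) *: x.
Proof.
rewrite (lseq_swap l_ops (s1 := [::]) (ds1 := [::]) isT (graded_nseq m) Gx Gv) /=.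
rewrite (lseq_x_inside 0) -scalerA -l_c lseqE add0n mulr0 expr0z scalerA.
by rewrite exprS.
Qed.

Section SingleV.
Variables (n : nat) (d : n.-tuple int) (e : 'I_n -> V) (i : 'I_n).
Hypotheses (di : tnth d i = 0) (ei : e i = v).
Hypothesis dw : forall k, k != i -> tnth d k = 1.
Hypothesis ew : forall k, k != i -> e k = w.

(** The common sign of all summands: the cost of moving v to the front of
    the tensor. *)
Let head_sign : F := \prod_(k : 'I_n | (k < i)%N) -1.

Lemma map_w t : i \notin t -> map e t = nseq (size t) w.
Proof.
elim: t => //= k t IHt; rewrite inE negb_or eq_sym => /andP[ki /IHt->].
by rewrite ew.
Qed.

Lemma swap_sign_v k : swap_sign F d i k = -1.
Proof. by rewrite /swap_sign di mul0r expr0z. Qed.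

Lemma word_sign_w t : i \notin t -> word_sign F d t = 1.
Proof.
elim: t => //= k t IHt; rewrite inE negb_or eq_sym => /andP[ki it].
rewrite IHt // mulr1 big_seq_cond big1 // => m /andP[mt _].
have mi : m != i by apply: contraNneq it => <-.
by rewrite /swap_sign !dw // mulr1 -[_ ^ 1]/(-1) opprK.
Qed.

(** Two labels of w's can be exchanged without a sign, so only the inversions
    that involve [i] count, and with [i] in front these are the labels below
    [i], whatever the order of the others. *)
Lemma word_sign_v t : perm_eq (i :: t) (enum 'I_n) ->
  word_sign F d (i :: t) = head_sign.
Proof.
move=> t_enum; have it : i \notin t.
  by have := enum_uniq 'I_n; rewrite -(perm_uniq t_enum) /= => /andP[].
rewrite /= word_sign_w // mulr1 (eq_bigr (fun=> -1)) => [|k _]; last exact: swap_sign_v.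
by rewrite enumT in t_enum; rewrite /head_sign -(perm_big _ t_enum) big_cons ltnn.
Qed.

Lemma word_sign_v_inside t1 t2 : i \notin t1 ->
  word_sign F d (t1 ++ i :: t2) = (-1) ^+ size t1 * word_sign F d (i :: t1 ++ t2).
Proof.
elim/last_ind: t1 t2 => [|t1 k IHt] t2; first by rewrite mul1r.
rewrite mem_rcons inE negb_or eq_sym => /andP[ki it1].
rewrite !cat_rcons word_sign_swap // swap_signC swap_sign_v IHt // size_rcons.
by rewrite exprS -!mulrA.
Qed.

Lemma single_v_graded k : e k \in G (tnth d k).
Proof.
by have [->|ki] := eqVneq k i; [rewrite ei di | rewrite ew // dw].
Qed.

(** If v is an inner argument, the inner operation gives [a _ *: w] and the outer
    one sees only w's.  If v is an outer argument, the inner operation gives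
    [b _ *: x]; bringing v past the [#|A|] inner w's and x past the
    [n - #|A|] remaining outer arguments yields the total sign (-1)^n. *)
Lemma nested_single_v (A : {set 'I_n}) : (0 < #|A|)%N ->
  nested l d e (enum A) (enum (~: A)) =
    (head_sign * (if i \in A then a #|A| * b (n - #|A|).+1
                  else (-1) ^+ n * b #|A| * c (n - #|A|).+1)) *: x.
Proof.
move=> A_gt0; have A_size : (0 < size (enum A))%N by rewrite -cardE.
have out_size : size (enum (~: A)) = (n - #|A|)%N.
  by rewrite -cardE cardsCs setCK card_ord.
have pull (B : {set 'I_n}) : i \in B -> exists t,
    [/\ perm_eq (enum B) (i :: t), i \notin t & size t = #|B|.-1].
  move=> iB; have iB' : i \in enum B by rewrite mem_enum.
  exists (rem i (enum B)); split; first exact: perm_to_rem.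
    by rewrite mem_rem_uniqF ?enum_uniq.
  by rewrite size_rem // -cardE.
have setP : perm_eq (enum A ++ enum (~: A)) (enum 'I_n) := set_word_perm A.
case: ifPn => iA.
  have [t [tA it t_size]] := pull A iA.
  have iC : i \notin enum (~: A) by rewrite mem_enum inE iA.
  rewrite (nested_perm l_ops single_v_graded A_size tA (perm_refl _)) /nested.
  rewrite [_ ++ _]cat_cons word_sign_v; last first.
    by rewrite -cat_cons -(permPr setP) perm_cat2r perm_sym.
  rewrite /= ei !map_w // t_size out_size.
  rewrite -(lseqE l [tuple of v :: nseq #|A|.-1 w]) l_a prednK //.
  rewrite (lseqZ l_ops [::]) /= -[_ :: _]/(nseq (n - #|A|).+1 w).
  by rewrite -(lseqE l [tuple of nseq _ w]) l_b !scalerA -mulrA.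
have iC : i \in ~: A by rewrite inE.
have iA' : i \notin enum A by rewrite mem_enum.
have [t [tC it t_size]] := pull (~: A) iC.
have C_size : #|~: A| = (n - #|A|)%N by rewrite cardE.
rewrite (nested_perm l_ops single_v_graded A_size (perm_refl _) tC) /nested.
rewrite word_sign_v_inside // word_sign_v; last first.
  rewrite -(permPr setP) -cat1s perm_catCA /= perm_cat2l.
  by rewrite perm_sym.
rewrite /= ei !map_w // t_size C_size -cardE -{2}(prednK A_gt0).
rewrite -(lseqE l [tuple of nseq _ w]) l_b prednK // (lseqZ l_ops [::]) /=.
have lt_An : (0 < n - #|A|)%N by rewrite -C_size; apply/card_gt0P; exists i.
rewrite lseq_x_first !scalerA prednK //.
have -> : (-1) ^+ n = (-1) ^+ #|A| * (-1) ^+ (n - #|A|) :> F.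
  by rewrite -exprD subnKC // ltnW // -subn_gt0.
by congr (_ *: _); ring.
Qed.

(** The terms with [c] are reindexed by p -> n + 1 - p, which turns the product
    of [b] at [p] and [c] at [n - p + 1] into that of [c] at [p] and [b] at
    [n - p + 1], and flips the sign.  For p = 1 the truncated [p - 2] produces a
    spurious binomial coefficient 1, harmless because [c 1] is zero. *)
Lemma jacobi_single_v : c 1%N = 0 -> jacobi l d (mktuple e) =
  (head_sign * \sum_(1 <= p < n.+1) (-1) ^+ (p * (n - p)) * b (n - p).+1 *
    ('C(n - 1, p - 1)%:R * a p - 'C(n - 1, p - 2)%:R * c p)) *: x.
Proof.
move=> c1; have n_gt0 : (0 < n)%N := leq_ltn_trans (leq0n i) (ltn_ord i).
have nE t1 t2 : nested l d (tnth (mktuple e)) t1 t2 = nested l d e t1 t2.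
  by rewrite /nested !(eq_map (tnth_mktuple e)).
rewrite jacobiE; transitivity ((head_sign * \sum_(1 <= p < n.+1) (-1) ^+ (p * (n - p)) *
    ('C(n - 1, p - 1)%:R * (a p * b (n - p).+1) +
     'C(n - 1, p)%:R * ((-1) ^+ n * b p * c (n - p).+1))) *: x).
  rewrite mulr_sumr scaler_suml; apply: eq_big_nat => p /andP[p_gt0 _].
  rewrite mulrCA -[in RHS]scalerA; congr (_ *: _).
  pose f (iA : bool) :=
    if iA then a p * b (n - p).+1 else (-1) ^+ n * b p * c (n - p).+1.
  rewrite -/(f true) -/(f false) -(sum_sets_mem i f p_gt0) mulr_sumr scaler_suml.
  by apply: eq_bigr => A /eqP Ap; rewrite nE nested_single_v Ap.
congr (_ * _ *: _).
under eq_bigr do rewrite mulrDr.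
under [in RHS]eq_bigr do rewrite mulrBr.
rewrite !big_split /=; congr (_ + _); first by apply: eq_bigr => p _; ring.
rewrite big_nat_rev /=; apply: eq_big_nat => p /andP[p_gt0 le_pn].
case: p p_gt0 le_pn => [//|[_ _|p _ le_pn]].
  by rewrite c1 !mulr0 oppr0 add1n !subSS subn0 bin_small ?mul0r ?mulr0 // subn1 prednK.
have {le_pn} [r nr] : exists r, n = (p.+2 + r)%N by exists (n - p.+2)%N; rewrite subnKC.
have -> : (1 + n.+1 - p.+3 = r.+1)%N by rewrite nr; lia.
have -> : ((n - r.+1).+1 = p.+2)%N by rewrite nr; lia.
have -> : ((n - p.+2).+1 = r.+1)%N by rewrite nr; lia.
have -> : (n - 1 = p + r.+1)%N by rewrite nr; lia.
have -> : (n - r.+1 = p.+1)%N by rewrite nr; lia.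
have -> : (n - p.+2 = r)%N by rewrite nr; lia.
have -> : 'C(p + r.+1, r.+1) = 'C(p + r.+1, p.+2 - 2).
  by rewrite -bin_sub ?leq_addl // addnK subn2.
have sE : (-1) ^+ (r.+1 * p.+1) * (-1) ^+ n = - (-1) ^+ (p.+2 * r) :> F.
  rewrite -exprD -[RHS]mulN1r -[RHS]exprS -signr_odd -[RHS]signr_odd nr; congr (_ ^+ _).
  by rewrite /= !(oddD, oddM) /=; case: (odd p); case: (odd r).
transitivity ((-1) ^+ (r.+1 * p.+1) * (-1) ^+ n *
    ('C(p + r.+1, p.+2 - 2)%:R * b r.+1 * c p.+2)); first by ring.
by rewrite sE; ring.
Qed.

End SingleV.

End ThreeDimensional.

(** * Solving the equations for the coefficients *)

Section JacobiCoefficients.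
Variables (F : fieldType) (a b c : nat -> F).

Definition jacobi_coef n : F :=
  \sum_(1 <= p < n.+1) (-1) ^+ (p * (n - p)) * b (n - p).+1 *
    ('C(n - 1, p - 1)%:R * a p - 'C(n - 1, p - 2)%:R * c p).

Definition jacobi_summand k m p : F :=
  (-1) ^+ (p * (m + k)) * b (m + k - p)%N *
    ('C(m + k - 2, p - 1)%:R * a p - 'C(m + k - 2, p - 2)%:R * c p).

Variable k : nat.
Hypotheses (k_gt0 : (0 < k)%N) (bk0 : b k != 0).
Hypothesis b0 : forall p, (0 < p < k)%N -> b p = 0.

Lemma jacobi_coef_small n : (n < k)%N -> jacobi_coef n = 0.
Proof.
move=> nk; rewrite /jacobi_coef big_nat big1 // => p /andP[p_gt0 le_pn].
by rewrite b0 ?mulr0 ?mul0r //; lia.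
Qed.

(** For p > m the index m + k - p of [b] is below [k]; the signs agree since
    p (m + k - 1 - p) and p (m + k) differ by the even number p (p + 1). *)
Lemma jacobi_coef_trunc m : (0 < m)%N ->
  jacobi_coef (m + k - 1) = \sum_(1 <= p < m.+1) jacobi_summand k m p.
Proof.
move=> m_gt0; rewrite /jacobi_coef (@big_cat_nat _ _ _ m.+1) //=; last by lia.
rewrite [X in _ + X]big_nat [X in _ + X]big1 ?addr0 => [|p /andP[lt_mp le_pn]]; last first.
  by rewrite b0 ?mulr0 ?mul0r //; lia.
apply: eq_big_nat => p /andP[p_gt0 le_pm]; rewrite /jacobi_summand.
have -> : ((m + k - 1 - p).+1 = m + k - p)%N by lia.
have -> : (m + k - 1 - 1 = m + k - 2)%N by lia.
congr (_ * _ * _); rewrite -signr_odd -[RHS]signr_odd; congr (_ ^+ _).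
have -> : (m + k = (m + k - 1 - p) + p.+1)%N by lia.
rewrite !(oddM, oddD) /= (_ : (m + k - 1 - p + p.+1 - 1 - p = m + k - 1 - p)%N); last by lia.
by case: (odd p); case: (odd (m + k - 1 - p)).
Qed.

Hypothesis char0 : [pchar F] =i pred0.
Hypothesis c1 : c 1%N = 0.

(** The sum up to [m] is affine in [a m], with leading coefficient
    (-1)^(m (m+k)) C(m+k-2, m-1) (b k); the coefficient of [c m] in the quotient
    comes from C(m+k-2, m-2) = (m-1)/k C(m+k-2, m-1).  The term p = 1 drops out
    for m > 1 thanks to [a 1 = 0], and for m = 1 it is the whole equation. *)
Lemma jacobi_coef_solve m : (0 < m)%N -> (1 < m)%N ==> (a 1%N == 0) ->
  (jacobi_coef (m + k - 1) == 0) =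
  (a m == (m%:R - 1) / k%:R * c m + (\sum_(2 <= p < m) jacobi_summand k m p) /
            ((-1) ^+ (m * (m + k) + 1) * 'C(m + k - 2, m - 1)%:R * b k)).
Proof.
move=> m_gt0 a1; rewrite jacobi_coef_trunc //.
have natF j : (j%:R == 0 :> F) = (j == 0)%N by exact: (proj1 (pcharf0P F) char0).
case: m => [//|[|m]] in m_gt0 a1 *.
  rewrite big_nat1 big_geq // subrr !mul0r addr0 /jacobi_summand add1n subSS subn0 bin0.
  by rewrite c1 mulr0 subr0 mul1r !mulf_eq0 signr_eq0 (negPf bk0).
rewrite big_ltn // big_nat_recr //=.
rewrite {1}/jacobi_summand (eqP a1) c1 !mulr0 subr0 mulr0 add0r.
set S := \sum_(2 <= p < _) _; rewrite /jacobi_summand.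
have -> : (m.+2 + k - m.+2 = k)%N by lia.
have -> : (m.+2 + k - 2 = m + k)%N by lia.
have -> : (m.+2 - 1 = m.+1)%N by lia.
have -> : (m.+2 - 2 = m)%N by lia.
rewrite addn1 exprS mulN1r; set s : F := (-1) ^+ _.
have s0 : s != 0 by rewrite signr_eq0.
have C0 : 'C(m + k, m.+1)%:R != 0 :> F by rewrite natF -lt0n bin_gt0; lia.
have kF : k%:R != 0 :> F by rewrite natF -lt0n.
have -> : 'C(m + k, m)%:R = (m.+2%:R - 1) / k%:R * 'C(m + k, m.+1)%:R :> F.
  have binE : (m.+1 * 'C(m + k, m.+1) = k * 'C(m + k, m))%N.
    by rewrite mul_bin_left addKn.
  apply: (mulfI kF); rewrite -natrM -binE natrM -[m.+2]addn1 natrD addrK.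
  by field.
set C := 'C(_, _)%:R in C0 *; rewrite -[RHS]subr_eq0.
set z := (X in _ = (X == 0)).
have -> : S + s * b k * (C * a m.+2 - (m.+2%:R - 1) / k%:R * C * c m.+2)
    = s * b k * C * z.
  by rewrite /z; field; rewrite bk0 C0 oppr_eq0 s0 kF.
by rewrite 3!mulf_eq0 (negPf s0) (negPf bk0) (negPf C0).
Qed.

End JacobiCoefficients.

(** The equations with n < k are void, the others are those of
    [jacobi_coef_solve] with m = n - k + 1; the one for m = 1 provides the
    hypothesis [a 1 = 0] of all later ones. *)
Lemma jacobi_coef_eq0 (F : fieldType) (char0 : [pchar F] =i pred0)
    (a b c : nat -> F) (c1 : c 1%N = 0) :
  (forall n, (0 < n)%N -> jacobi_coef a b c n = 0) <->
  (forall p : nat, (0 < p)%N -> b p = 0) \/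
  (exists k : nat,
    [/\ (0 < k)%N,
        forall p : nat, (0 < p < k)%N -> b p = 0,
        b k != 0
      & forall m : nat, (0 < m)%N ->
        a m = (m%:R - 1) / k%:R * c m +
          (\sum_(2 <= p < m) jacobi_summand a b c k m p)
          / ((-1) ^+ (m * (m + k) + 1) * 'C(m + k - 2, m - 1)%:R * b k)]).
Proof.
split=> [E0|[b0 n n_gt0|[k [k_gt0 b0 bk0 aE]] n n_gt0]].
- have [b0|nb0] := classic (forall p, (0 < p)%N -> b p = 0); first by left.
  right; have exb : exists p, (0 < p)%N && (b p != 0).
    have [p nbp] := not_all_ex_not _ _ nb0; have [p_gt0 bp] := imply_to_and _ _ nbp.
    by exists p; rewrite p_gt0; apply/eqP.
  case: (ex_minnP exb) => k /andP[k_gt0 bk0] k_min; exists k.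
  have b0 p : (0 < p < k)%N -> b p = 0.
    move=> /andP[p_gt0 lt_pk]; apply/eqP/negPn/negP => bp.
    by have := k_min p; rewrite p_gt0 bp leqNgt lt_pk => /(_ isT).
  split=> // m m_gt0; apply/eqP; rewrite -jacobi_coef_solve ?E0 //; first by lia.
  apply/implyP=> _; have := @jacobi_coef_solve _ a b c k k_gt0 bk0 b0 char0 c1 1.
  have k1_gt0 : (0 < 1 + k - 1)%N by rewrite add1n subn1.
  rewrite E0 // eqxx => /(_ isT isT).
  by rewrite big_geq // c1 mulr0 mul0r addr0 => <-.
- by rewrite /jacobi_coef big1 // => p _; rewrite b0 // mulr0 mul0r.
have [nk|le_kn] := ltnP n k; first exact: jacobi_coef_small nk.
have -> : n = ((n - k).+1 + k - 1)%N by lia.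
have a1 : a 1%N = 0 by rewrite aE // big_geq // subrr !mul0r addr0.
apply/eqP; rewrite jacobi_coef_solve //; first by apply/eqP/aE.
by rewrite a1 eqxx implybT.
Qed.

(** * The criterion for an L-infinity structure *)

Theorem corollary3p10 (F : fieldType) (char0 : [pchar F] =i pred0)
    (V : vectType F) (G : grading V) (v w x : V)
    (v_neq0 : v != 0) (w_neq0 : w != 0) (x_neq0 : x != 0)
    (G0 : G 0 = <[v]>%VS) (G1 : G 1 = <[w]>%VS) (G2 : G 2 = <[x]>%VS)
    (Gother : forall i : int, i \notin [:: 0; 1; 2] -> G i = 0%VS)
    (a b c : nat -> F) (c1 : c 1%N = 0)
    (l : forall r : nat, r.-tuple V -> V)
    (l_ops : graded_operators G l)
    (l_a : forall r : nat, l r.+1 [tuple of v :: nseq r w] = a r.+1 *: w)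
    (l_b : forall r : nat, l r.+1 [tuple of nseq r.+1 w] = b r.+1 *: x)
    (l_c : forall r : nat,
      l r.+2 [tuple of v :: rcons (nseq r w) x] = c r.+2 *: x)
    (l_other : forall (r : nat) (t : r.-tuple V), (0 < r)%N ->
      {subset t <= [:: v; w; x]} ->
      ~~ perm_eq t (v :: nseq r.-1 w) ->
      ~~ perm_eq t (nseq r w) ->
      ~~ perm_eq t (v :: rcons (nseq (r - 2) w) x) ->
      l r t = 0) :
  Linfty G l <->
  (forall p : nat, (0 < p)%N -> b p = 0) \/
  (exists k : nat,
    [/\ (0 < k)%N,
        forall p : nat, (0 < p < k)%N -> b p = 0,
        b k != 0
      & forall m : nat, (0 < m)%N ->
        a m = (m%:R - 1) / k%:R * c m +
          (\sum_(2 <= p < m)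
              (-1) ^+ (p * (m + k)) * b (m + k - p)%N *
              ('C(m + k - 2, p - 1)%:R * a p - 'C(m + k - 2, p - 2)%:R * c p))
          / ((-1) ^+ (m * (m + k) + 1) * 'C(m + k - 2, m - 1)%:R * b k)]).
Proof.
have Gv : v \in G 0 by rewrite G0 memv_line.
have Gw : w \in G 1 by rewrite G1 memv_line.
have Gx : x \in G 2 by rewrite G2 memv_line.
apply: iff_trans (jacobi_coef_eq0 char0 a b c1).
pose basis (z : int) := if z == 0 then v else if z == 1 then w else x.
split=> [[_ J0] n n_gt0|E0].
  (* The equation E_n = 0 is read off from the tensor v, w, ..., w. *)
  pose i0 := Ordinal n_gt0.
  pose d := [tuple (k != i0)%:Z | k < n].
  pose e k := basis (tnth d k).
  have di : tnth d i0 = 0 by rewrite tnth_mktuple eqxx.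
  have dw k : k != i0 -> tnth d k = 1 by rewrite tnth_mktuple => ->.
  have ei : e i0 = v by rewrite /e di.
  have ew k : k != i0 -> e k = w by rewrite /e => /dw->.
  have := jacobi_single_v Gv Gw Gx l_ops l_a l_b l_c di ei dw ew c1.
  rewrite J0 // => [/esym/eqP|k]; last first.
    by rewrite tnth_mktuple; exact: (single_v_graded Gv Gw di ei dw ew).
  rewrite scaler_eq0 (negPf x_neq0) orbF mulf_eq0 => /orP[|/eqP//].
  rewrite prodf_seq_eq0 => /hasP[j _ /andP[_]].
  by rewrite oppr_eq0 oner_eq0.
split=> // n n_gt0 d y dy.
have big_deg (z : int) u : 2 < z -> u \in G z -> u = 0.
  move=> z_gt2; rewrite Gother ?memv0 => [/eqP//|].
  by rewrite !inE; lia.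
(* Each argument is a multiple of the basis vector of its degree; in a degree
   where V is zero the vector [basis] is arbitrary and the scalar is 0. *)
have /fin_all_exists[k kP] (i : 'I_n) : exists k : F,
    tnth y i = k *: basis (tnth d i) /\ (tnth d i \notin [:: 0; 1; 2 : int] -> k = 0).
  have := dy i; have [d_in|d_out] := boolP (tnth d i \in [:: 0; 1; 2 : int]); last first.
    by rewrite Gother // memv0 => /eqP->; exists 0; rewrite scale0r.
  suff -> : G (tnth d i) = <[basis (tnth d i)]>%VS.
    by move=> /vlineP[k ->]; exists k.
  by move: d_in; rewrite !inE /basis => /or3P[]/eqP->.
pose e i := basis (tnth d i).
rewrite (@jacobi_scale _ _ _ _ l_ops _ d k y (mktuple e)); last first.
  by move=> i; rewrite tnth_mktuple; have [] := kP i.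
have [/forallP d_in|] := boolP [forall i, tnth d i \in [:: 0; 1; 2 : int]]; last first.
  move=> /forallPn[i /(proj2 (kP i)) ki]; rewrite (bigD1 i) //= ki mul0r.
  exact: scale0r.
have {kP y dy} de i : e i \in G (tnth d i).
  by have := d_in i; rewrite /e !inE /basis => /or3P[]/eqP->.
have dx : homogeneous G d (mktuple e) by move=> i; rewrite tnth_mktuple.
have Jdeg := jacobi_degree l_ops dx.
suff -> : jacobi l d (mktuple e) = 0 by rewrite scaler0.
have d_pos i : tnth d i != 0 -> 1 <= tnth d i.
  by have := d_in i; rewrite !inE => /or3P[]/eqP->.
have nE : n%:Z = \sum_(i < n) 1 by rewrite sumr_const card_ord natz.
(* Apart from a single v, all degrees are at least 1: without v, or with one v
   that an x compensates, the value has degree at least 3. *)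
case: (pickP (fun i => tnth d i == 0)) => [i /eqP di|no_v]; last first.
  apply: big_deg Jdeg; suff : n%:Z <= \sum_i tnth d i by lia.
  by rewrite nE; apply: ler_sum => i _; rewrite d_pos ?no_v.
case: (pickP (fun j => (j != i) && (tnth d j == 0))) => [j /andP[ji /eqP dj]|one_v].
  apply: (jacobi_repeat l_ops _ dx ji) => //.
    by rewrite (proj1 (pcharf0P F) char0).
  by rewrite !tnth_mktuple /e di dj.
case: (pickP (fun j => tnth d j == 2)) => [j /eqP dj|no_x].
  apply: big_deg Jdeg; suff : n%:Z <= \sum_i tnth d i by lia.
  have ji : j != i by apply: contra_eq_neq dj => ->; rewrite di.
  rewrite nE [leLHS](bigD1 i) //= [leRHS](bigD1 i) //= di add0r.
  rewrite [X in 1 + X](bigD1 j) //= [leRHS](bigD1 j) //= dj addrA lerD2l.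
  apply: ler_sum => m /andP[mi _]; rewrite d_pos //; apply/negP => dm.
  by have := one_v m; rewrite mi dm.
have dw m : m != i -> tnth d m = 1.
  move=> mi; have := d_in m; rewrite !inE (no_x m) orbF => /orP[dm0|/eqP//].
  by have := one_v m; rewrite mi dm0.
have ew m : m != i -> e m = w by rewrite /e => /dw->.
have ei : e i = v by rewrite /e di.
rewrite (jacobi_single_v Gv Gw Gx l_ops l_a l_b l_c di ei dw ew c1).
by have := E0 n n_gt0; rewrite /jacobi_coef => ->; rewrite mulr0 scale0r.
Qed.
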